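(* Let $\lambda$ be a straight or skew shape with $n$ boxes. Then for every $m\in\mathbb N=\{1,2,3,\dots\}$, $\rho^{\lambda,m}\cong S^\lambda\uparrow_{S_n}^{B_n}$.
   Context: $B_n$ is the group of permutations $\pi$ of $\{\pm1,\dots,\pm n\}$ with $\pi(-i)=-\pi(i)$, with Coxeter generators $s_0=(-1,1)$ and $s_i=(i,i+1)(-i,-i-1)$, $1\le i\le n-1$; $S_n=\langle s_1,\dots,s_{n-1}\rangle$, identified with the symmetric group via $s_i\mapsto(i\,\,i{+}1)$. $S^\lambda$ is the representation of $S_n$ on the space with basis the standard Young tableaux $Q$ of shape $\lambda$ filled with $1,\dots,n$, given by $(i\,\,i{+}1)(Q)=\frac1hQ+\sqrt{1-\frac1{h^2}}\,Q^{s_i}$, with $h$ the content of $i+1$ minus the content of $i$ in $Q$ (content of box in row $r$, column $j$ being $j-r$) and $Q^{s_i}$ obtained by swapping $i,i+1$. For a B-Young tableau, the content of the box in row $r$, column $j$ is $j-r+\frac12$. A B-Young tableau is a filling of a skew diagram by $\pm1,\dots,\pm n$, one per box, with $c_{-k}=-c_k$ ($c_k$ the content of the box containing $k$); standard means increasing along rows and down columns. A B-Young tableau is regarded as determined by its positive-content part. For $\pi\in B_n$, $T^\pi$ is $T$ with each entry $k$ replaced by $\pi(k)$. For $m\in\mathbb N$, $T[\lambda,m]$ is the set of standard B-Young tableaux whose positive-content boxes form the shape $\lambda$ and whose smallest positive content is $m+\frac12$. For such $T$ with content vector $(c_1,\dots,c_n)$ let $f(T)=(2c_1,c_2-c_1,\dots,c_n-c_{n-1})$.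 $\rho^{\lambda,m}$ is the representation of $B_n$ on the vector space with basis $T[\lambda,m]$ given by $\rho_{s_i}(T)=\frac1{f_i(T)}T+\sqrt{1-\frac1{f_i(T)^2}}\,T^{s_i}$, $i=0,\dots,n-1$ (the second term vanishing when $f_i(T)=\pm1$, i.e. when $T^{s_i}$ is not standard). *)

(* Defs.v *)
From HB Require Import structures.
From mathcomp Require Import all_boot all_order all_algebra all_fingroup.
From mathcomp Require Import all_field all_character.
Set Implicit Arguments.
Unset Strict Implicit.
Unset Printing Implicit Defensive.
Import Order.TTheory GRing.Theory Num.Theory.
Local Open Scope ring_scope.

(* The set {+-1,...,+-n} is encoded as 'I_n * bool : (k, b) stands for  *)
(* the signed integer  (if b then -1 else 1) * (k+1).                   *)
(* Group multiplication is mathcomp's: (s * t) x = t (s x).             *)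

Definition sgn_elt (n : nat) := ('I_n * bool)%type.
Definition gT (n : nat) := {perm sgn_elt n}.

Definition negs n (x : sgn_elt n) : sgn_elt n := (x.1, ~~ x.2).

Definition sval n (x : sgn_elt n) : int :=
  if x.2 then - (x.1.+1)%:Z else (x.1.+1)%:Z.

Definition Bn (n : nat) : {set gT n} :=
  [set p : gT n | [forall x, p (negs x) == negs (p x)]].

Definition Sn (n : nat) : {set gT n} :=
  [set p in Bn n | [forall x, (p x).2 == x.2]].

(* Coxeter generators: s_0 = (-1,1), s_i = (i,i+1)(-i,-i-1), 1 <= i <= n-1.
   The generator s_i is indexed by i : 'I_n. Entry i (1-indexed) has
   index i-1, entry i+1 has index i. *)
Definition predo n (i : 'I_n) : 'I_n :=
  Ordinal (leq_ltn_trans (leq_pred i) (ltn_ord i)).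

Definition sgen n (i : 'I_n) : gT n :=
  if i == 0%N :> nat then tperm (i, false) (i, true)
  else (tperm (predo i, false) (i, false) * tperm (predo i, true) (i, true))%g.

(* Skew shapes mu / nu (straight shapes: nu = [::]).  Rows and columns  *)
(* are 0-indexed; this does not change contents differences.           *)

Definition is_skew_shape (mu nu : seq nat) :=
  sorted geq mu /\ sorted geq nu /\ (forall r, nth 0 nu r <= nth 0 mu r)%N.

Section Shape.
Variables (mu nu : seq nat).

Local Notation cellT := ('I_(size mu) * 'I_(head 0%N mu))%type.

Definition in_shape (b : cellT) : bool :=
  (nth 0 nu b.1 <= b.2)%N && (b.2 < nth 0 mu b.1)%N.

Definition content (b : cellT) : int := (b.2)%:Z - (b.1)%:Z.

Definition same_row (b1 b2 : cellT) := b1.1 == b2.1.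
Definition same_col (b1 b2 : cellT) := b1.2 == b2.2.

Variable n : nat.

(* A tableau Q is encoded by Q k = the cell containing the entry k+1. *)
Definition is_syt (Q : {ffun 'I_n -> cellT}) : bool :=
  [&& injectiveb Q,
      [forall k, in_shape (Q k)],
      [forall b, in_shape b ==> (b \in codom Q)],
      [forall k, forall l,
         same_row (Q k) (Q l) ==> ((Q k).2 < (Q l).2)%N ==> (k < l)%N] &
      [forall k, forall l,
         same_col (Q k) (Q l) ==> ((Q k).1 < (Q l).1)%N ==> (k < l)%N]].

Definition SYT : {set {ffun 'I_n -> cellT}} := [set Q | is_syt Q].

Definition syt_swap (i : 'I_n) (Q : {ffun 'I_n -> cellT}) : {ffun 'I_n -> cellT} :=
  [ffun k => Q (tperm (predo i) i k)].

Definition syt_h (i : 'I_n) (Q : {ffun 'I_n -> cellT}) : algC :=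
  (content (Q i) - content (Q (predo i)))%:~R.

(* Matrix of (i i+1) acting on S^lambda, for 1 <= i <= n-1.  Row
   convention: entry (Q, Q') is the coefficient of Q' in (i i+1)(Q). *)
Definition young_mx (i : 'I_n) : 'M[algC]_(#|SYT|) :=
  \matrix_(a, b)
    let Q := enum_val a in let Q' := enum_val b in
    let h := syt_h i Q in
    (Q' == Q)%:R * h^-1 + (Q' == syt_swap i Q)%:R * sqrtC (1 - (h ^+ 2)^-1).

(* ---------------- Standard B-Young tableaux in T[lambda, m] *)
(* Such a tableau is determined by its positive-content part, which is *)
(* a filling of lambda by one of +k / -k for each k = 1..n.  It is     *)
(* encoded by T k = (cell containing +-(k+1), true iff the sign is -). *)
Definition btab := {ffun 'I_n -> cellT * bool}.

Definition bcell (T : btab) (k : 'I_n) : cellT := (T k).1.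
Definition bentry (T : btab) (k : 'I_n) : int := sval (k, (T k).2).

Definition is_btab (T : btab) : bool :=
  [&& injectiveb (bcell T),
      [forall k, in_shape (bcell T k)],
      [forall b, in_shape b ==> (b \in codom (bcell T))],
      [forall k, forall l,
         same_row (bcell T k) (bcell T l) ==>
         ((bcell T k).2 < (bcell T l).2)%N ==> (bentry T k < bentry T l)] &
      [forall k, forall l,
         same_col (bcell T k) (bcell T l) ==>
         ((bcell T k).1 < (bcell T l).1)%N ==> (bentry T k < bentry T l)]].

Variable m : nat.

Definition BT : {set btab} := [set T | is_btab T].

Definition min_content : int :=
  let s := [seq content b | b <- enum [set: cellT] & in_shape b] in
  foldr Num.min (head 0 s) s.

(* content of a cell of the positive part: the translate of lambda whose *)
(* smallest content is m + 1/2 *)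
Definition bcontent_cell (b : cellT) : algC :=
  (content b - min_content + m%:Z)%:~R + 2^-1.

(* c_k (k = index, i.e. entry k+1) with c_{-k} = - c_k *)
Definition bc (T : btab) (k : 'I_n) : algC :=
  if (T k).2 then - bcontent_cell (bcell T k) else bcontent_cell (bcell T k).

Definition bf (i : 'I_n) (T : btab) : algC :=
  if i == 0%N :> nat then 2 * bc T i else bc T i - bc T (predo i).

(* T^pi: each entry x replaced by pi(x) *)
Definition btab_act (p : gT n) (T : btab) : btab :=
  [ffun k => let y := (p^-1)%g (k, false) in ((T y.1).1, (T y.1).2 (+) y.2)].

(* matrix of rho_{s_i}; entry (T, T') is the coefficient of T' in rho_{s_i}(T) *)
Definition btab_mx (i : 'I_n) : 'M[algC]_(#|BT|) :=
  \matrix_(a, b)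
    let T := enum_val a in let T' := enum_val b in
    let f := bf i T in
    (T' == T)%:R * f^-1 + (T' == btab_act (sgen i) T)%:R * sqrtC (1 - (f ^+ 2)^-1).

End Shape.

Section Induced.
Variables (T : finGroupType) (G H : {set T}) (d : nat) (sigma : T -> 'M[algC]_d).

Definition rtrans : {set T} := transversal (rcosets H G) G.

(* Induced (row) representation: basis e_i (x) t, t in X; *)
(* (e_i (x) t) g = e_i sigma(t g t'^-1) (x) t', where t g in H t'. *)
Definition ind_rep (g : T) : 'M[algC]_(\sum_(a < #|rtrans|) d) :=
  \mxblock_(a < #|rtrans|, b < #|rtrans|)
    (let t := enum_val a in let t' := enum_val b in
     if t' == transversal_repr 1%g rtrans ((H :* (t * g))%g) then
       sigma (t * g * t'^-1)%g
     else (0 : 'M[algC]_d)).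
End Induced.

Definition rep_iso (T : finGroupType) (G : {set T}) n1 n2
  (r1 : T -> 'M[algC]_n1) (r2 : T -> 'M[algC]_n2) : Prop :=
  exists B : 'M[algC]_(n1, n2),
    [/\ n1 = n2, row_free B & forall x, x \in G -> r1 x *m B = B *m r2 x].

(* Main.v *)
Require Import Defs.
From HB Require Import structures.
From mathcomp Require Import all_boot all_order all_algebra all_fingroup.
From mathcomp Require Import all_field all_character ring zify.
Import Order.TTheory GRing.Theory Num.Theory.
Local Open Scope ring_scope.

(* The matrices [M i] of the generators on [T[lambda, m]] satisfy the Coxeter
   relations of type B, so the elements [M j ... M 1 M 0 M 1 ... M j] that play
   the role of the sign changes commute, and the [M i] with [i > 0] permute
   them. The all-positive tableaux span a copy of [S^lambda] for [S_n].
   Writing [t] in [B_n] as a permutation times a sign change, this gives a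
   Frobenius-reciprocity map from the induced module that intertwines the
   generators without appealing to a presentation of [B_n].
   It is onto, since a box with a negative entry can be made positive by
   generators whose off-diagonal coefficient does not vanish (this is where
   [m > 0] enters), and standardization gives [#|T[lambda, m]| >= 2^n f^lambda],
   so it is bijective; [rho] is the induced action transported along it. *)

Set Implicit Arguments.
Unset Strict Implicit.
Unset Printing Implicit Defensive.

(** * Sign changes built from elements satisfying the Coxeter relations of type B *)

Lemma commr_conj (R : pzRingType) (x y z : R) :
  GRing.comm x y -> GRing.comm x z -> GRing.comm x (y * z * y).
Proof. by move=> xy xz; apply: commrM => //; apply: commrM. Qed.

(** The leading [x y x] becomes [y x y], its last [y] passes [z], and the braid [y x y] formed on
    the right turns back into [x y x]. *)
Lemma braid_commr_conj (R : pzRingType) (x y z : R) :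
  x * y * x = y * x * y -> y * z = z * y ->
  GRing.comm x (y * (x * z * x) * y).
Proof.
move=> b c; rewrite /GRing.comm.
transitivity ((x * y * x) * (z * (x * y))); first by rewrite !mulrA.
rewrite b -(mulrA (y * x)) (mulrA y z) c -(mulrA z) (mulrA y x y) -b.
by rewrite !mulrA.
Qed.

Section CoxeterB.
Variables (R : pzRingType) (n : nat) (M : nat -> R).
Hypothesis MM : forall i, (i < n)%N -> M i * M i = 1.
Hypothesis Mcomm : forall i j, (i.+1 < j)%N -> (j < n)%N -> M i * M j = M j * M i.
Hypothesis Mbraid3 : forall i, (0 < i)%N -> (i.+1 < n)%N ->
  M i * M i.+1 * M i = M i.+1 * M i * M i.+1.
Hypothesis Mbraid4 : (1 < n)%N ->
  M 0%N * M 1%N * M 0%N * M 1%N = M 1%N * M 0%N * M 1%N * M 0%N.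

(** Models the reflection negating entry [j+1], a conjugate of the one negating entry 1. Natural
    indices keep the recursion free of bounds. *)
Fixpoint refl (j : nat) : R :=
  if j is j'.+1 then M j * refl j' * M j else M 0%N.

Definition nswap (i j : nat) : nat :=
  if j == i then i.-1 else if j == i.-1 then i else j.

Lemma refl_comm_gt i j : (j.+1 < i)%N -> (i < n)%N -> GRing.comm (M i) (refl j).
Proof.
elim: j => [|j IH] ji lin; first by apply: commr_sym; exact: Mcomm.
have ij : GRing.comm (M i) (M j.+1) by apply: commr_sym; exact: Mcomm.
by apply: commr_conj => //; apply: IH; lia.
Qed.

Lemma refl_comm_lt i j : (0 < i)%N -> (i < j)%N -> (j < n)%N ->
  GRing.comm (M i) (refl j).
Proof.
move=> i0; elim: j => // j IH; rewrite ltnS leq_eqVlt => /orP[/eqP ij|ij] jn.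
  subst j; case: i i0 IH jn => // i _ _ jn.
  apply: braid_commr_conj; first exact: Mbraid3.
  by apply: refl_comm_gt; lia.
apply: commr_conj; [exact: Mcomm|apply: IH => //; lia].
Qed.

(** For [j] equal to [i] or [i-1] the outer conjugation is removed or created using [M i * M i = 1];
    any other [refl j] commutes with [M i]. *)
Lemma refl_swap i j : (0 < i < n)%N -> (j < n)%N ->
  refl j * M i = M i * refl (nswap i j).
Proof.
move=> /andP[i0 lin] ljn; rewrite /nswap; case: eqP => [->|/eqP ji].
  by case: i i0 lin {ljn} => // i _ lin /=; rewrite -!mulrA MM // mulr1.
case: eqP => [->|/eqP ji1].
  by case: i i0 lin {ljn ji} => // i _ lin /=; rewrite !mulrA MM // mul1r.
apply/esym; case: (ltnP i j) => ij; first exact: refl_comm_lt.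
apply: refl_comm_gt => //; lia.
Qed.

(** Induction on [j], then on [k] when [j = 0], peels off outer generators that commute with the
    other reflection. What remains is [M 0] against [M 1 * M 0 * M 1], the braid relation of length
    four. *)
Lemma refl_commr j k : (j < k)%N -> (k < n)%N -> GRing.comm (refl j) (refl k).
Proof.
move=> jk kn; elim: j jk => [|j IH] jk; last first.
  apply: commr_sym; apply: commr_conj.
    by apply: commr_sym; apply: refl_comm_lt.
  by apply: commr_sym; apply: IH; lia.
elim: k jk kn => // k IH _ kn; case: k IH kn => [|k] IH kn.
  by rewrite /GRing.comm /= !mulrA Mbraid4.
apply: commr_conj; last by apply: IH => //; lia.
by apply: commr_sym; apply: (@refl_comm_gt _ 0).
Qed.

Definition reflX (A : nat -> bool) j : R := if A j then refl j else 1.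
Definition reflset (A : nat -> bool) (k : nat) : R := \prod_(j < k) reflX A j.

Lemma reflsetS A k : reflset A k.+1 = reflset A k * reflX A k.
Proof. by rewrite /reflset big_ord_recr. Qed.

Lemma eq_reflset A B k : (forall j, (j < k)%N -> A j = B j) ->
  reflset A k = reflset B k.
Proof. by move=> AB; apply: eq_bigr => j _; rewrite /reflX AB. Qed.

Lemma reflset_comm A i k : (k < i)%N -> (i < n)%N ->
  GRing.comm (reflset A k) (M i).
Proof.
move=> ki lin; apply: commr_sym; apply: commr_prod => j _; rewrite /reflX.
by case: ifP => _; [apply: refl_comm_gt => //; have := ltn_ord j; lia|apply: commr1].
Qed.

Lemma reflset_swap A i k : (0 < i < k)%N -> (k <= n)%N ->
  reflset A k * M i = M i * reflset (A \o nswap i) k.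
Proof.
move=> /andP[i0]; elim: k => // k IH; rewrite ltnS leq_eqVlt => /orP[/eqP ik|ik] kn.
  (* Here [i] is the last index of the product: the last two factors are exchanged by the generator,
     and [refl_commr] restores their order when both are present. *)
  subst k; case: i i0 IH kn => // i _ _ kn; rewrite !reflsetS.
  have c := reflset_comm A (leqnn i.+1) kn.
  have ss : reflset (A \o nswap i.+1) i = reflset A i.
    apply: eq_reflset => j ji /=; rewrite /nswap.
    by case: eqP => [|_]; [lia|case: eqP => //=; lia].
  have c' : M i.+1 * reflset A i = reflset A i * M i.+1.
    by apply: commr_sym; apply: reflset_comm.
  rewrite ss !mulrA c' -!mulrA; congr (_ * _).
  have s1 := @refl_swap i.+1 i kn (ltnW kn).
  have s2 := @refl_swap i.+1 i.+1 kn kn.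
  have r12 := refl_commr (leqnn i.+1) kn.
  have n1 : nswap i.+1 i = i.+1 by rewrite /nswap /= eqxx; case: eqP => //; lia.
  have n2 : nswap i.+1 i.+1 = i by rewrite /nswap eqxx.
  rewrite n1 in s1; rewrite n2 in s2.
  rewrite /reflX /= n1 n2; case: (A i); case: (A i.+1); rewrite ?mulr1 ?mul1r //.
  by rewrite s2 mulrA s1 -mulrA r12.
rewrite !reflsetS mulrA -IH //; last by apply: ltnW.
rewrite -!mulrA; congr (_ * _).
have nk : nswap i k = k by rewrite /nswap; do 2?[case: eqP => [|_]; first lia].
rewrite /reflX /= nk; case: ifP => _; last by rewrite mulr1 mul1r.
by rewrite refl_swap ?nk //; lia.
Qed.

(** [M 0] is [refl 0]: it commutes with all later factors, so it reaches the factor of index 0 and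
    toggles it. *)
Lemma reflset_flip A k : (0 < k)%N -> (k <= n)%N ->
  reflset A k * M 0%N = reflset (fun j => A j (+) (j == 0%N)) k.
Proof.
elim: k => // k IH _ kn; case: k IH kn => [|k] IH kn.
  rewrite /reflset !big_ord1 /reflX /= eqxx addbT.
  by case: (A 0%N); rewrite /= ?mul1r // MM.
rewrite reflsetS [RHS]reflsetS -IH //; last by apply: ltnW.
rewrite -!mulrA; congr (_ * _); rewrite /reflX /= addbF.
case: ifP => _; last by rewrite mulr1 mul1r.
exact: (esym (@refl_commr 0%N k.+1 isT kn)).
Qed.

End CoxeterB.

(** * Scalar identities behind the two braid relations *)

Section BraidIdentities.
Variable F : fieldType.

(** [A], [B], [D] stand for [1/a], [1/b], [1/(a+b)], and [v], [v1], [v12], ... for coordinates of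
    the tableaux reached by partial braid words. The difference of the two sides is a combination of
    multiples of [A * B - D * (A + B)]. *)
Lemma braid3_identity (A B D ga gb gd v v1 v2 v12 v21 v121 : F) :
  A * B = D * (A + B) -> ga ^+ 2 = 1 - A ^+ 2 -> gb ^+ 2 = 1 - B ^+ 2 ->
  A * (B * (A * v + ga * v1) + gb * (D * v2 + gd * v21))
  + ga * (D * (- A * v1 + ga * v) + gd * (B * v12 + gb * v121)) =
  B * (A * (B * v + gb * v2) + ga * (D * v1 + gd * v12))
  + gb * (D * (- B * v2 + gb * v) + gd * (A * v21 + ga * v121)).
Proof.
move=> h ha hb; apply/eqP; rewrite -subr_eq0; apply/eqP.
transitivity (((A ^+ 2 * B + ga ^+ 2 * D) - (B ^+ 2 * A + gb ^+ 2 * D)) * v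
  + (A * B - D * (A + B)) * (ga * v1) - (A * B - D * (A + B)) * (gb * v2)); first by ring.
rewrite h subrr !mul0r subr0 addr0 ha hb.
transitivity ((A - B) * (A * B - D * (A + B)) * v); first by ring.
by rewrite h subrr mulr0 mul0r.
Qed.

(** For contents [x], [y] of the entries 1 and 2, the reciprocals are [al = 1/(2x)], [be = 1/(2y)],
    [p = 1/(y-x)], [q = 1/(x+y)]. Both relations compute [p * q], so [al * (p - q) - be * (p + q)]
    vanishes, and it is a factor of the difference of the sides. *)
Lemma braid4_identity (al be p q ga gb gp gq v v0 v1 v01 v10 v010 v101 w : F) :
  al * (p - q) = p * q -> be * (p + q) = p * q ->
  ga ^+ 2 = 1 - al ^+ 2 -> gb ^+ 2 = 1 - be ^+ 2 ->
  gp ^+ 2 = 1 - p ^+ 2 -> gq ^+ 2 = 1 - q ^+ 2 ->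
  al * (p * (al * (p * v + gp * v1) + ga * (q * v0 + gq * v01))
        + gp * (be * (- p * v1 + gp * v) + gb * (q * v10 + gq * v101)))
  + ga * (q * (- al * (q * v0 + gq * v01) + ga * (p * v + gp * v1))
          + gq * (be * (- q * v01 + gq * v0) + gb * (p * v010 + gp * w))) =
  p * (al * (p * (al * v + ga * v0) + gp * (be * v1 + gb * v10))
       + ga * (q * (- al * v0 + ga * v) + gq * (be * v01 + gb * v010)))
  + gp * (be * (- p * (be * v1 + gb * v10) + gp * (al * v + ga * v0))
          + gb * (q * (- be * v10 + gb * v1) + gq * (al * v101 + ga * w))).
Proof.
move=> hal hbe ha hb hp hq; apply/eqP; rewrite -subr_eq0; apply/eqP.
have h : al * (p - q) - be * (p + q) = 0 by rewrite hal hbe subrr.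
transitivity ((- al * q ^+ 2 + 2 * al * p * q + be * gq ^+ 2 - al * p ^+ 2
                 - be * gp ^+ 2) * (ga * v0)
  + (al ^+ 2 * p - 2 * al * be * p + be ^+ 2 * p + ga ^+ 2 * q - gb ^+ 2 * q)
      * (gp * v1)
  + (al * (p - q) - be * (p + q)) * (ga * gq * v01)
  - (al * (p - q) - be * (p + q)) * (gp * gb * v10)); first by ring.
rewrite h !mul0r subr0 addr0 ha hb hp hq.
transitivity ((al * (p - q) - be * (p + q)) *
  ((al - be) * (gp * v1) - (p - q) * (ga * v0))); first by ring.
by rewrite h mul0r.
Qed.

End BraidIdentities.

(** * Partitions, and the generators as permutations of signed indices *)

Lemma nth_geq_sorted (s : seq nat) i j : sorted geq s -> (i <= j)%N ->
  (nth 0 s j <= nth 0 s i)%N.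
Proof.
move=> ss ij; case: (ltnP j (size s)) => js; last by rewrite nth_default.
have gt : transitive geq by move=> a b c /= ? ?; lia.
by apply: (sorted_leq_nth gt (fun=> leqnn _)) => //; rewrite inE //; lia.
Qed.

Lemma nswap_spec i k : k = i /\ nswap i k = i.-1 \/
  k <> i /\ (k = i.-1 /\ nswap i k = i \/ k <> i.-1 /\ nswap i k = k).
Proof.
rewrite /nswap; case: eqP => [|?]; first by left.
by right; split=> //; case: eqP; [left|right].
Qed.

Lemma val_tperm_predo n (i k : 'I_n) : tperm (predo i) i k = nswap i k :> nat.
Proof.
rewrite /nswap; case: tpermP => [->|->|h1 h2] /=; last first.
- case: eqP => [/val_inj /h2 //|_]; case: eqP => // e.
  by case: h1; apply: val_inj.
- by rewrite eqxx.
by rewrite eqxx; case: eqP.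
Qed.

Lemma sgenE n (i k : 'I_n) b : sgen i (k, b) =
  if i == 0%N :> nat then (k, b (+) (k == i)) else (tperm (predo i) i k, b).
Proof.
rewrite /sgen; case: ifP => i0.
  by case: tpermP => [[-> ->]|[-> ->]|h1 h2]; rewrite ?eqxx //; case: eqP => [e|_];
     case: b h1 h2 => // h1 h2; rewrite e in h1 h2.
rewrite permM; case: (tpermP (predo i, false)) => [[-> ->]|[-> ->]|h1 h2].
- by rewrite tpermL tpermD // xpair_eqE andbF.
- by rewrite tpermR tpermD // xpair_eqE andbF.
case: (tpermP (predo i, true)) => [[-> ->]|[-> ->]|h3 h4]; rewrite ?tpermL ?tpermR //.
by rewrite tpermD //; apply/eqP => e; subst k; case: b h1 h2 h3 h4.
Qed.

Lemma sgenV n (i : 'I_n) : (sgen i)^-1%g = sgen i.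
Proof.
apply/eqP; rewrite eq_invg_mul; apply/eqP/permP => -[k b]; rewrite permM perm1.
rewrite !sgenE; case: ifP => i0; rewrite sgenE i0; first by rewrite -addbA addbb addbF.
by rewrite tpermK.
Qed.

(** * Standard B-Young tableaux: contents of close entries and the effect of a generator *)

Section Tableaux.
Variables (mu nu : seq nat) (n : nat).
Hypothesis skew : is_skew_shape mu nu.
Local Notation cellT := ('I_(size mu) * 'I_(head 0%N mu))%type.
Local Notation btab := (btab mu n).
Local Notation BT := (BT mu nu n).

(** [nu] decreases weakly, so the left end of the row of [b] is bounded by that of [b1]; [mu]
    decreases weakly, so its right end is at least that of [b2]. *)
Lemma in_shape_convex (b1 b2 b : cellT) : in_shape nu b1 -> in_shape nu b2 ->
  (b1.1 <= b.1)%N -> (b1.2 <= b.2)%N -> (b.1 <= b2.1)%N -> (b.2 <= b2.2)%N ->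
  in_shape nu b.
Proof.
case: skew => smu [snu _] /andP[h1 _] /andP[_ h2] r1 c1 r2 c2; apply/andP.
have := nth_geq_sorted snu r1; have := nth_geq_sorted smu r2; lia.
Qed.

Lemma BTP (T : btab) : T \in BT ->
  [/\ injective (bcell T), forall k, in_shape nu (bcell T k),
      forall b, in_shape nu b -> exists k, bcell T k = b,
      forall k l, (bcell T k).1 = (bcell T l).1 ->
        ((bcell T k).2 < (bcell T l).2)%N -> bentry T k < bentry T l
    & forall k l, (bcell T k).2 = (bcell T l).2 ->
        ((bcell T k).1 < (bcell T l).1)%N -> bentry T k < bentry T l].
Proof.
rewrite inE => /and5P[/injectiveP h1 /forallP h2 /forallP h3 /forallP h4 /forallP h5].
split=> //.
- by move=> b bs; have := h3 b; rewrite bs /= => /codomP[k ->]; exists k.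
- move=> k l e h; have := h4 k => /forallP/(_ l).
  by rewrite /same_row e eqxx h.
move=> k l e h; have := h5 k => /forallP/(_ l).
by rewrite /same_col e eqxx h.
Qed.

Lemma BTI (T : btab) : injective (bcell T) -> (forall k, in_shape nu (bcell T k)) ->
  (forall b, in_shape nu b -> exists k, bcell T k = b) ->
  (forall k l, (bcell T k).1 = (bcell T l).1 ->
        ((bcell T k).2 < (bcell T l).2)%N -> bentry T k < bentry T l) ->
  (forall k l, (bcell T k).2 = (bcell T l).2 ->
        ((bcell T k).1 < (bcell T l).1)%N -> bentry T k < bentry T l) ->
  T \in BT.
Proof.
move=> h1 h2 h3 h4 h5; rewrite inE; apply/and5P; split.
- exact/injectiveP.
- exact/forallP.
- by apply/forallP => b; apply/implyP => /h3[k <-]; apply: codom_f.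
- by apply/forallP => k; apply/forallP => l; apply/implyP => /eqP e; apply/implyP; apply: h4.
by apply/forallP => k; apply/forallP => l; apply/implyP => /eqP e; apply/implyP; apply: h5.
Qed.

Lemma bentryE (T : btab) k :
  bentry T k = if (T k).2 then - (k.+1)%:Z else (k.+1)%:Z.
Proof. by []. Qed.

Lemma bentry_inj (T : btab) : injective (bentry T).
Proof.
move=> k l; rewrite !bentryE => e; apply: val_inj; move: e.
by case: (T k).2; case: (T l).2 => /=; lia.
Qed.

(** By convexity the box in the row of [k] and the column of [l] belongs to the shape; one goes
    along the row to it, then down the column. *)
Lemma BT_le (T : btab) k l : T \in BT ->
  ((bcell T k).1 <= (bcell T l).1)%N -> ((bcell T k).2 <= (bcell T l).2)%N ->
  bentry T k <= bentry T l.
Proof.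
move=> /BTP[inj ins cov row col] h1 h2.
have [p Ep] : exists p, bcell T p = ((bcell T k).1, (bcell T l).2).
  by apply: cov; apply: in_shape_convex (ins k) (ins l) _ _ _ _ => /=.
apply: (@le_trans _ _ (bentry T p)).
  move: h2; rewrite leq_eqVlt => /orP[/eqP/val_inj e|h2].
    by rewrite (inj p k) // Ep -e -surjective_pairing.
  by apply/ltW/row; rewrite Ep.
move: h1; rewrite leq_eqVlt => /orP[/eqP/val_inj e|h1].
  by rewrite (inj p l) // Ep e -surjective_pairing.
by apply/ltW/col; rewrite Ep.
Qed.

Lemma BT_lt (T : btab) k l : T \in BT -> k != l ->
  ((bcell T k).1 <= (bcell T l).1)%N -> ((bcell T k).2 <= (bcell T l).2)%N ->
  bentry T k < bentry T l.
Proof.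
move=> BT kl h1 h2; rewrite lt_neqAle BT_le // andbT.
by apply: contraNneq kl => /bentry_inj ->.
Qed.

(* A 2x2 square separates two boxes on a diagonal, so two further entries lie
   strictly between those of the two boxes. *)
Lemma BT_diag (T : btab) k l : T \in BT -> k != l ->
  content (bcell T k) = content (bcell T l) -> bentry T k < bentry T l ->
  exists p q, [/\ p != q, bentry T k < bentry T p < bentry T l
                & bentry T k < bentry T q < bentry T l].
Proof.
move=> BT kl e lt; have [inj ins cov row col] := BTP BT.
have r : ((bcell T k).1 < (bcell T l).1)%N.
  case: (ltnP (bcell T k).1 (bcell T l).1) => // h; have : bentry T l <= bentry T k.
    by apply: BT_le => //; move: e; rewrite /content; lia.
  by rewrite leNgt lt.
have c : ((bcell T k).2 < (bcell T l).2)%N by move: e; rewrite /content; lia.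
pose r1 := Ordinal (leq_ltn_trans r (ltn_ord (bcell T l).1)).
pose c1 := Ordinal (leq_ltn_trans c (ltn_ord (bcell T l).2)).
have [p Ep] : exists p, bcell T p = ((bcell T k).1, c1).
  apply: cov; apply: in_shape_convex (ins k) (ins l) _ _ _ _ => //=; lia.
have [q Eq] : exists q, bcell T q = (r1, (bcell T k).2).
  apply: cov; apply: in_shape_convex (ins k) (ins l) _ _ _ _ => //=; lia.
have neq x y : bcell T x <> bcell T y -> x != y
  by move=> h; apply/eqP => E; rewrite E in h.
exists p, q; split.
- by apply: neq; rewrite Ep Eq => -[/(congr1 val) /=]; lia.
- apply/andP; split; apply: BT_lt => //; rewrite ?Ep //=; try lia.
  + by apply: neq; rewrite Ep => /(congr1 (fun b => val b.2)) /=; lia.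
  + by apply: neq; rewrite Ep => /(congr1 (fun b => val b.1)) /=; lia.
apply/andP; split; apply: BT_lt => //; rewrite ?Eq //=; try lia.
- by apply: neq; rewrite Eq => /(congr1 (fun b => val b.1)) /=; lia.
- by apply: neq; rewrite Eq => /(congr1 (fun b => val b.2)) /=; lia.
Qed.

(** Contrapositive of [BT_diag]: at most one entry between two others is too few for them to share a
    diagonal. The next three lemmas use it to keep denominators in the braid relations nonzero. *)
Lemma BT_content_neq (T : btab) k l : T \in BT -> k != l ->
  (forall p q, (bentry T k < bentry T p < bentry T l)
       || (bentry T l < bentry T p < bentry T k) ->
     (bentry T k < bentry T q < bentry T l)
       || (bentry T l < bentry T q < bentry T k) -> p = q) ->
  content (bcell T k) != content (bcell T l).
Proof.
move=> BT kl h; apply/eqP => e.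
have : bentry T k != bentry T l by apply: contra kl => /eqP/bentry_inj ->.
rewrite neq_lt => /orP[lt|lt].
  have [p [q [pq hp hq]]] := BT_diag BT kl e lt.
  by move/eqP: pq; apply; apply: h; rewrite ?hp ?hq.
have lk : l != k by rewrite eq_sym.
have [p [q [pq hp hq]]] := BT_diag BT lk (esym e) lt.
by move/eqP: pq; apply; apply: h; rewrite ?hp ?hq orbT.
Qed.

Lemma BT_content_adj (T : btab) (i : 'I_n) : T \in BT -> (0 < i)%N ->
  (T (predo i)).2 = (T i).2 -> content (bcell T (predo i)) != content (bcell T i).
Proof.
move=> BT i0 e; apply: BT_content_neq => //.
  by apply/eqP => /(congr1 val) /=; lia.
move=> p q; rewrite !bentryE e; move: (T i).2 (T p).2 => [] [] /=; lia.
Qed.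

(** Only an entry of absolute value [i+1] can lie between those of absolute values [i] and [i+2]
    with a common sign. *)
Lemma BT_content_adj2 (T : btab) (i j : 'I_n) : T \in BT -> (0 < i)%N -> j = i.+1 :> nat ->
  (T (predo i)).2 = (T j).2 -> content (bcell T (predo i)) != content (bcell T j).
Proof.
move=> BT i0 ij e; apply: BT_content_neq => //.
  by apply/eqP => /(congr1 val) /=; lia.
move=> p q; rewrite !bentryE e => hp hq; apply: val_inj; move: hp hq.
move: (T j).2 (T p).2 (T q).2 => [] [] [] /=; lia.
Qed.

(** Between 1 and -2, or between -1 and 2, the only nonzero integer has absolute value 1, and that
    absolute value is already taken. *)
Lemma BT_content_adj0 (T : btab) (i : 'I_n) : T \in BT -> i = 1%N :> nat ->
  (T (predo i)).2 = ~~ (T i).2 -> content (bcell T (predo i)) != content (bcell T i).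
Proof.
move=> BT i1 e; apply: BT_content_neq => //.
  by apply/eqP => /(congr1 val) /=; lia.
move=> p q; rewrite !bentryE e.
have [->|/eqP pi] := eqVneq p i; first by case: (T i).2 => /=; lia.
have [->|/eqP pp] := eqVneq p (predo i); first by rewrite e; case: (T i).2 => /=; lia.
have : nat_of_ord p <> i by move=> /val_inj.
have : nat_of_ord p <> i.-1 by move=> E; apply: pp; apply: val_inj.
move: (T i).2 (T p).2 => [] [] /=; lia.
Qed.

Lemma BT_adjacent (T : btab) k l : T \in BT ->
  (forall p, ~ bentry T k < bentry T p < bentry T l) ->
  ((bcell T k).1 = (bcell T l).1) /\ ((bcell T k).2 < (bcell T l).2)%N \/
  ((bcell T k).2 = (bcell T l).2) /\ ((bcell T k).1 < (bcell T l).1)%N ->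
  (content (bcell T l) - content (bcell T k)) ^+ 2 = 1.
Proof.
move=> BT no; have [inj ins cov row col] := BTP BT.
case=> -[e lt].
  have [h|h] : ((bcell T l).2 = (bcell T k).2.+1 :> nat)%N \/
    ((bcell T k).2.+1 < (bcell T l).2)%N by lia.
    rewrite /content e h; ring.
  pose c1 := Ordinal (leq_ltn_trans lt (ltn_ord (bcell T l).2)).
  have [p Ep] : exists p, bcell T p = ((bcell T k).1, c1).
    by apply: cov; apply: in_shape_convex (ins k) (ins l) _ _ _ _ => //=; rewrite ?e; lia.
  by case: (no p); apply/andP; split; apply: row; rewrite Ep.
have [h|h] : ((bcell T l).1 = (bcell T k).1.+1 :> nat)%N \/
    ((bcell T k).1.+1 < (bcell T l).1)%N by lia.
  rewrite /content e h; ring.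
pose r1 := Ordinal (leq_ltn_trans lt (ltn_ord (bcell T l).1)).
have [p Ep] : exists p, bcell T p = (r1, (bcell T k).2).
  by apply: cov; apply: in_shape_convex (ins k) (ins l) _ _ _ _ => //=; rewrite ?e; lia.
by case: (no p); apply/andP; split; apply: col; rewrite Ep.
Qed.

Definition bswap (i : 'I_n) (T : btab) : btab := btab_act (sgen i) T.

Lemma bswap0E (i : 'I_n) T k : i = 0%N :> nat ->
  bswap i T k = ((T k).1, (T k).2 (+) (k == i)).
Proof. by move=> i0; rewrite ffunE sgenV sgenE i0. Qed.

Lemma bswapE (i : 'I_n) T k : (0 < i)%N -> bswap i T k = T (tperm (predo i) i k).
Proof.
move=> i0; rewrite ffunE sgenV sgenE -(negbK (_ == _)) -lt0n i0 /= addbF.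
by rewrite -surjective_pairing.
Qed.

Lemma bswapK (i : 'I_n) : involutive (bswap i).
Proof.
move=> T; apply/ffunP => k; case: (posnP i) => i0.
  by rewrite !bswap0E //= -addbA addbb addbF -surjective_pairing.
by rewrite !bswapE // tpermK.
Qed.

(** No other entry lies between -1 and 1, so changing the sign of this one entry preserves all
    comparisons. *)
Lemma bswap_BT0 (i : 'I_n) T : i = 0%N :> nat -> T \in BT -> bswap i T \in BT.
Proof.
move=> i0 BT; have [inj ins cov row col] := BTP BT.
have c k : bcell (bswap i T) k = bcell T k by rewrite /bcell bswap0E.
have en k l : bentry T k < bentry T l -> bentry (bswap i T) k < bentry (bswap i T) l.
  have [->|/eqP kl] := eqVneq k l; first by rewrite ltxx.
  have {}kl : nat_of_ord k <> l by move/val_inj.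
  rewrite !bentryE !bswap0E //= -!(inj_eq val_inj) /= i0.
  case: (T k).2; case: (T l).2; case: eqP => hk; case: eqP => hl /=; lia.
apply: BTI.
- by move=> k l; rewrite !c; apply: inj.
- by move=> k; rewrite c.
- by move=> b /cov[k <-]; exists k.
- by move=> k l; rewrite !c => e h; apply/en/row.
- by move=> k l; rewrite !c => e h; apply/en/col.
Qed.

(** Exchanging absolute values [i] and [i+1] reverses only the comparison of these two entries, and
    only if their signs agree. If that comparison is imposed by a common row or column,
    [BT_adjacent] makes the boxes neighbours. *)
Lemma bswap_BT (i : 'I_n) T : (0 < i)%N -> T \in BT ->
  bswap i T \in BT \/ (T i).2 = (T (predo i)).2 /\
     (content (bcell T i) - content (bcell T (predo i))) ^+ 2 = 1.
Proof.
move=> i0 BT; have [inj ins cov row col] := BTP BT.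
case: (boolP [&& (T i).2 == (T (predo i)).2 &
     (content (bcell T i) - content (bcell T (predo i))) ^+ 2 == 1]).
  by case/andP => /eqP h1 /eqP h2; right.
move=> bad; left.
set t := tperm (predo i) i.
have c k : bcell (bswap i T) k = bcell T (t k) by rewrite /bcell bswapE.
have tK : involutive t by exact: tpermK.
have en k l : ((bcell T k).1 = (bcell T l).1) /\ ((bcell T k).2 < (bcell T l).2)%N \/
  ((bcell T k).2 = (bcell T l).2) /\ ((bcell T k).1 < (bcell T l).1)%N ->
  bentry (bswap i T) (t k) < bentry (bswap i T) (t l).
  move=> h; have lt : bentry T k < bentry T l by case: h => -[]; [apply: row|apply: col].
  have adj : (T k).2 = (T l).2 ->
    (k = i /\ l = predo i) \/ (k = predo i /\ l = i) -> False.
    move=> e kl; have h2 : (content (bcell T l) - content (bcell T k)) ^+ 2 = 1.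
      apply: BT_adjacent => // p; move: lt; rewrite !bentryE.
      case: kl e => -[-> ->]; case: (T _).2; case: (T _).2 => // _ ; case: (T p).2 => /=; lia.
    move/negP: bad; apply; case: kl e h2 => -[-> ->] e h2; rewrite e eqxx -?h2 /=;
      apply/eqP => //; ring.
  move: lt; rewrite !bentryE !bswapE // !tK !val_tperm_predo.
  have ek : nat_of_ord k = i -> k = i by move/val_inj.
  have el : nat_of_ord l = i -> l = i by move/val_inj.
  have ek' : nat_of_ord k = i.-1 -> k = predo i by move=> E; apply: val_inj.
  have el' : nat_of_ord l = i.-1 -> l = predo i by move=> E; apply: val_inj.
  have {}adj : (T k).2 = (T l).2 ->
    (nat_of_ord k = i /\ nat_of_ord l = i.-1) \/
    (nat_of_ord k = i.-1 /\ nat_of_ord l = i) -> False.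
    by move=> e [[/ek ? /el' ?]|[/ek' ? /el ?]]; apply: adj => //; [left|right].
  clear ek el ek' el'; move: adj; rewrite /nswap.
  case: (T k).2; case: (T l).2 => /= adj;
   do 4?[case: eqP => ?]; try lia.
apply: BTI.
- by move=> k l; rewrite !c => /inj/(can_inj tK).
- by move=> k; rewrite c.
- by move=> b /cov[k <-]; exists (t k); rewrite c tK.
- by move=> k l; rewrite !c => e h; rewrite -(tK k) -(tK l); apply: en; left.
- by move=> k l; rewrite !c => e h; rewrite -(tK k) -(tK l); apply: en; right.
Qed.

End Tableaux.

(** * Coefficients of the generators, and the Coxeter relations for their matrices *)

Lemma foldr_min_le (s : seq int) (a x : int) : x \in s -> foldr Num.min a s <= x.
Proof.
elim: s => //= y s IH; rewrite inE ge_min => /orP[/eqP->|/IH->]; first by rewrite lexx.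
by rewrite orbT.
Qed.

Lemma min_content_le (mu nu : seq nat) (b : 'I_(size mu) * 'I_(head 0%N mu)) :
  in_shape nu b -> min_content mu nu <= content b.
Proof.
move=> bs; apply: foldr_min_le; apply/mapP; exists b => //.
by rewrite mem_filter bs mem_enum inE.
Qed.

Definition gcoef (f : algC) : algC := sqrtC (1 - (f ^+ 2)^-1).

Lemma gcoefN f : gcoef (- f) = gcoef f.
Proof. by rewrite /gcoef sqrrN. Qed.

Lemma gcoef2 f : gcoef f ^+ 2 = 1 - f^-1 ^+ 2.
Proof. by rewrite /gcoef sqrtCK exprVn. Qed.

Lemma gcoef_eq0 f : (gcoef f == 0) = (f ^+ 2 == 1).
Proof. by rewrite sqrtC_eq0 subr_eq0 eq_sym invr_eq1. Qed.

Section Matrices.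
Variables (mu nu : seq nat) (n m : nat).
Hypotheses (skew : is_skew_shape mu nu) (m0 : (0 < m)%N).
Local Notation btab := (btab mu n).
Local Notation BT := (BT mu nu n).
Local Notation bswap := (@bswap mu n).
Local Notation bf := (@bf mu nu n m).
Local Notation bc := (@bc mu nu n m).
Local Notation M := (@btab_mx mu nu n m).

(* Twice the content, an odd integer. *)
Definition bcZ (T : btab) (k : 'I_n) : int :=
  let z := content (bcell T k) - min_content mu nu + m%:Z in
  if (T k).2 then - (2 * z + 1) else 2 * z + 1.

Lemma bcE T k : bc T k = (bcZ T k)%:~R / 2.
Proof.
rewrite /bc /bcZ /bcontent_cell; set z := _ + m%:Z; move: z => z.
by case: (T k).2; rewrite ?rmorphN /= (rmorphD _ (2 * z)) rmorphM /=; field.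
Qed.

Lemma bfE i T : bf i T = if i == 0%N :> nat then (bcZ T i)%:~R
  else (bcZ T i - bcZ T (predo i))%:~R / 2.
Proof.
by rewrite /bf !bcE; case: ifP => _; rewrite ?rmorphB /=; field.
Qed.

(** Contents in the positive part are at least [m + 1/2], hence at least [3/2] because [m > 0]. This
    bound also separates contents of opposite sign. *)
Lemma bcZ_ge3 (T : btab) k : T \in BT -> if (T k).2 then bcZ T k <= -3 else 3 <= bcZ T k.
Proof.
move=> /BTP[_ ins _ _ _]; have := min_content_le (ins k).
by rewrite /bcZ; case: (T k).2; lia.
Qed.

Lemma bcZ_neq0 (T : btab) k : T \in BT -> bcZ T k != 0.
Proof. by move=> /(@bcZ_ge3 T k); case: (T k).2; lia. Qed.

Lemma bcZ_adj (T : btab) (i : 'I_n) : T \in BT -> (0 < i)%N -> bcZ T i != bcZ T (predo i).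
Proof.
move=> TB i0; have := bcZ_ge3 i TB; have := bcZ_ge3 (predo i) TB.
have := BT_content_adj skew TB i0.
by rewrite /bcZ; case: (T i).2; case: (T (predo i)).2 => h; try have := h erefl; lia.
Qed.

Lemma bcZ_adj2 (T : btab) (i j : 'I_n) : T \in BT -> (0 < i)%N -> j = i.+1 :> nat ->
  bcZ T j != bcZ T (predo i).
Proof.
move=> TB i0 ij; have := bcZ_ge3 j TB; have := bcZ_ge3 (predo i) TB.
have := BT_content_adj2 skew TB i0 ij.
by rewrite /bcZ; case: (T j).2; case: (T (predo i)).2 => h; try have := h erefl; lia.
Qed.

Lemma bcZ_adj0 (T : btab) (i : 'I_n) : T \in BT -> i = 1%N :> nat ->
  bcZ T i + bcZ T (predo i) != 0.
Proof.
move=> TB i1; have := bcZ_ge3 i TB; have := bcZ_ge3 (predo i) TB.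
have := BT_content_adj0 skew TB i1.
by rewrite /bcZ; case: (T i).2; case: (T (predo i)).2 => h; try have := h erefl; lia.
Qed.

Lemma bc_bswap0 (i : 'I_n) T k : i = 0%N :> nat ->
  bc (bswap i T) k = if k == i then - bc T k else bc T k.
Proof.
move=> i0; rewrite /bc /bcell bswap0E //=.
by case: eqP => _; case: (T k).2; rewrite ?opprK.
Qed.

Lemma bc_bswap (i : 'I_n) T k : (0 < i)%N ->
  bc (bswap i T) k = bc T (tperm (predo i) i k).
Proof. by move=> i0; rewrite /bc /bcell bswapE. Qed.

Lemma bf_bswap (i : 'I_n) T : bf i (bswap i T) = - bf i T.
Proof.
rewrite /bf; case: ifP => /eqP i0; first by rewrite bc_bswap0 // eqxx mulrN.
rewrite !bc_bswap ?lt0n; try exact/eqP.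
by rewrite tpermL tpermR opprB.
Qed.

(* Zero when [T] is not standard. *)
Definition bvec (T : btab) : 'rV[algC]_#|BT| := \row_b (enum_val b == T)%:R.

Lemma bvec_out T : T \notin BT -> bvec T = 0.
Proof.
move=> TB; apply/rowP => b; rewrite !mxE; case: eqP => // e.
by rewrite -e enum_valP in TB.
Qed.

Lemma bvec_delta a : bvec (enum_val a) = delta_mx 0 a.
Proof. by apply/rowP => b; rewrite !mxE (inj_eq enum_val_inj). Qed.

Lemma bvec_inj p (A B : 'M[algC]_(#|BT|, p)) :
  (forall T, T \in BT -> bvec T *m A = bvec T *m B) -> A = B.
Proof.
move=> h; apply/row_matrixP => a; rewrite !rowE -bvec_delta.
by apply: h; apply: enum_valP.
Qed.

(* The formula also holds when [T] or [bswap i T] is not standard: either both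
   indicator rows vanish or the coefficient of the standard one does. *)
Lemma bvec_mul T i :
  bvec T *m M i = (bf i T)^-1 *: bvec T + gcoef (bf i T) *: bvec (bswap i T).
Proof.
case: (boolP (T \in BT)) => TB.
  rewrite -{1}(enum_rankK_in TB TB) bvec_delta -rowE.
  apply/rowP => b; rewrite !mxE (enum_rankK_in TB TB) /=.
  by rewrite mulrC; congr (_ + _); rewrite mulrC.
rewrite (bvec_out TB) mul0mx scaler0 add0r.
case: (boolP (bswap i T \in BT)) => TB'; last by rewrite bvec_out // scaler0.
have g0 : gcoef (bf i T) == 0; last by rewrite (eqP g0) scale0r.
rewrite -(bswapK i T) bf_bswap gcoefN gcoef_eq0 -[T in bf _ T](bswapK i).
rewrite bswapK; set T' := bswap i T in TB' *.
have ET : bswap i T' = T by rewrite /T' bswapK.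
case: (posnP i) => i0; first by rewrite -ET bswap_BT0 in TB.
case: (bswap_BT skew i0 TB'); rewrite ?ET ?(negPf TB) // => -[e h].
rewrite bfE (gtn_eqF i0) /bcZ -e; move: h.
set x := content _; set y := content _ => h.
(* [bcZ] doubles contents, so a content difference of square 1 shows up here as a difference of
   square 4. *)
have E (u v : int) : (u - v) ^+ 2 = 4 -> (((u - v)%:~R / 2) : algC) ^+ 2 == 1.
  move=> uv; rewrite expr_div_n -rmorphXn /= uv (_ : 4%:~R = 2 ^+ 2 :> algC).
    by rewrite divff // expf_neq0 // pnatr_eq0.
  by rewrite -natrX.
case: (T' i).2; apply: E.
  transitivity (4 * (x - y) ^+ 2); last by rewrite h.
  ring.
transitivity (4 * (x - y) ^+ 2); last by rewrite h.
ring.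
Qed.

Lemma scalemx_mull p q r (c : algC) (A : 'M_(p, q)) (B : 'M_(q, r)) :
  (c *: A) *m B = c *: (A *m B).
Proof. by rewrite scalemxAl. Qed.

(** Expands only binary combinations, which leaves [bvec] and the coefficients folded for [ring]. *)
Lemma lin2_mxE p (a b : algC) (u v : 'rV_p) k :
  (a *: u + b *: v) 0 k = a * u 0 k + b * v 0 k.
Proof. by rewrite !mxE. Qed.

Definition bvec_expand := (bvec_mul, mulmxDl, scalemx_mull).

(** Applying the generator twice, the cross terms cancel because [bf i] changes sign under [bswap i]
    while [gcoef] is even; the squares of the two coefficients add up to 1. *)
Lemma btab_mxK i : M i *m M i = 1%:M.
Proof.
apply: bvec_inj => T TB; rewrite mulmx1 mulmxA !bvec_expand bswapK bf_bswap gcoefN invrN.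
apply/rowP => j; rewrite !lin2_mxE.
transitivity (((bf i T)^-1 ^+ 2 + gcoef (bf i T) ^+ 2) * bvec T 0 j); first by ring.
by rewrite gcoef2 addrCA subrr addr0 mul1r.
Qed.

Lemma bswap_comm (i j : 'I_n) T : (i.+1 < j)%N -> bswap i (bswap j T) = bswap j (bswap i T).
Proof.
move=> ij; apply/ffunP => k; have j0 : (0 < j)%N by lia.
case: (posnP i) => i0.
  rewrite bswap0E // !(bswapE _ _ j0) bswap0E //; congr (_, _ (+) _).
  rewrite -!(inj_eq val_inj) /= val_tperm_predo.
  by have := nswap_spec j k; lia.
rewrite !bswapE // -!permM; congr (T (_ k)).
have : (tperm (predo j) j ^ tperm (predo i) i)%g = tperm (predo j) j.
  by rewrite tpermJ !tpermD // -(inj_eq val_inj) /=; lia.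
by rewrite conjgE tpermV => {1}<-; rewrite !mulgA tperm2 mul1g.
Qed.

Lemma bf_bswap_far (i j : 'I_n) T : (i.+1 < j)%N ->
  bf i (bswap j T) = bf i T /\ bf j (bswap i T) = bf j T.
Proof.
move=> ij; have j0 : (0 < j)%N by lia.
have h (k : 'I_n) : (k.+1 < j)%N -> bc (bswap j T) k = bc T k.
  move=> kj; rewrite bc_bswap // tpermD // -(inj_eq val_inj) /=; lia.
split; first by rewrite /bf !h //= ; lia.
have h' (k : 'I_n) : (i < k)%N -> bc (bswap i T) k = bc T k.
  move=> ik; case: (posnP i) => i0.
    by rewrite bc_bswap0 // -(inj_eq val_inj) /= gtn_eqF.
  by rewrite bc_bswap // tpermD // -(inj_eq val_inj) /=; lia.
by rewrite /bf !h' //=; lia.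
Qed.

Lemma btab_mx_comm (i j : 'I_n) : (i.+1 < j)%N -> M i *m M j = M j *m M i.
Proof.
move=> ij; apply: bvec_inj => T _; rewrite !mulmxA !bvec_expand (bswap_comm T ij).
have [e1 e2] := bf_bswap_far T ij; rewrite e1 e2.
by apply/rowP => k; rewrite !lin2_mxE; ring.
Qed.

Lemma bswap_braid3 (i j : 'I_n) T : (0 < i)%N -> j = i.+1 :> nat ->
  bswap i (bswap j (bswap i T)) = bswap j (bswap i (bswap j T)).
Proof.
move=> i0 ij; apply/ffunP => k; rewrite !bswapE ?ij // -!permM; congr (T (_ k)).
have pj : predo j = i by apply: val_inj; rewrite /= ij.
have ti : tperm (predo i) i j = j by apply: tpermD; rewrite -(inj_eq val_inj) /=; lia.
have tj : tperm i j (predo i) = predo i by apply: tpermD; rewrite -(inj_eq val_inj) /=; lia.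
have := tpermJ i j (tperm (predo i) i); have := tpermJ (predo i) i (tperm i j).
by rewrite !conjgE !tpermV ti tj tpermL tpermR pj => <- <-.
Qed.

Lemma btab_mx_braid3 (i j : 'I_n) : (0 < i)%N -> j = i.+1 :> nat ->
  M i *m M j *m M i = M j *m M i *m M j.
Proof.
move=> i0 ij; have j0 : (0 < j)%N by rewrite ij.
have pj : predo j = i by apply: val_inj; rewrite /= ij.
apply: bvec_inj => T TB; rewrite !mulmxA !bvec_expand (bswap_braid3 T i0 ij) !bswapK.
set a := bf i T; set b := bf j T.
have ni : (i == 0%N :> nat) = false by rewrite gtn_eqF.
have nj : (j == 0%N :> nat) = false by rewrite gtn_eqF.
have ti : tperm (predo i) i j = j by apply: tpermD; rewrite -(inj_eq val_inj) /=; lia.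
have tj : tperm i j (predo i) = predo i by apply: tpermD; rewrite -(inj_eq val_inj) /=; lia.
have fE U : bf i U = bc U i - bc U (predo i) by rewrite /bf ni.
have gE U : bf j U = bc U j - bc U i by rewrite /bf nj pj.
(* The swaps permute three consecutive contents, so each coefficient met along either braid word has
   parameter [a], [b] or [a + b] up to sign. *)
have e1 : bf i (bswap i T) = - a by rewrite bf_bswap.
have e2 : bf j (bswap i T) = a + b.
  rewrite /a /b !gE fE !bc_bswap // ti tpermR; ring.
have e3 : bf i (bswap j (bswap i T)) = b.
  by rewrite /b gE fE !bc_bswap // pj tj tpermL ti tpermL.
have e4 : bf i (bswap j T) = a + b.
  rewrite /a /b gE !fE !bc_bswap // pj tj tpermL; ring.
have e5 : bf j (bswap j T) = - b by rewrite bf_bswap.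
have e6 : bf j (bswap i (bswap j T)) = a.
  by rewrite /a gE fE !bc_bswap // ti pj !tpermR tj.
rewrite e1 e2 e3 e4 e5 e6 !gcoefN !invrN.
apply/rowP => k; rewrite !lin2_mxE.
apply: braid3_identity; rewrite ?gcoef2 //.
(* The denominators are the pairwise differences of the three contents, nonzero by the diagonal
   argument. *)
have a0 : a != 0.
  by rewrite /a bfE ni mulf_neq0 ?invr_eq0 ?pnatr_eq0 // intr_eq0 subr_eq0 bcZ_adj.
have b0 : b != 0.
  by rewrite /b bfE nj mulf_neq0 ?invr_eq0 ?pnatr_eq0 // intr_eq0 subr_eq0 bcZ_adj.
have ab0 : a + b != 0.
  have -> : a + b = (bcZ T j - bcZ T (predo i))%:~R / 2.
    by rewrite /a /b !bfE ni nj pj !rmorphB /=; field.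
  by rewrite mulf_neq0 ?invr_eq0 ?pnatr_eq0 // intr_eq0 subr_eq0 bcZ_adj2.
by field; rewrite a0 b0 ab0.
Qed.

Lemma bswap_braid4 (o i : 'I_n) T : o = 0%N :> nat -> i = 1%N :> nat ->
  bswap o (bswap i (bswap o (bswap i T))) = bswap i (bswap o (bswap i (bswap o T))).
Proof.
move=> o0 i1; have i0 : (0 < i)%N by rewrite i1.
apply/ffunP => k; do 2!rewrite !(bswap0E _ _ o0) !(bswapE _ _ i0).
rewrite !(bswap0E _ _ o0) tpermK /=.
by rewrite -!addbA [_ (+) (k == o)]addbC.
Qed.

Lemma btab_mx_braid4 (o i : 'I_n) : o = 0%N :> nat -> i = 1%N :> nat ->
  M o *m M i *m M o *m M i = M i *m M o *m M i *m M o.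
Proof.
move=> o0 i1; have i0 : (0 < i)%N by rewrite i1.
have pi : predo i = o by apply: val_inj; rewrite /= i1 o0.
have io : (i == o) = false by rewrite -(inj_eq val_inj) /= i1 o0.
apply: bvec_inj => T TB; rewrite !mulmxA !bvec_expand !bswapK (bswap_braid4 T o0 i1).
set x := bc T o; set y := bc T i.
have fE U : bf o U = 2 * bc U o by rewrite /bf o0.
have gE U : bf i U = bc U i - bc U o by rewrite /bf i1 /= pi.
(* The contents [x], [y] are only exchanged and negated, so the parameters along the braid are [2x],
   [2y], [y - x] and [x + y] up to sign. *)
have c1 U : bc (bswap i U) i = bc U o by rewrite bc_bswap // tpermR pi.
have c2 U : bc (bswap i U) o = bc U i by rewrite bc_bswap // pi tpermL.
have c3 U : bc (bswap o U) i = bc U i by rewrite bc_bswap0 // io.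
have c4 U : bc (bswap o U) o = - bc U o by rewrite bc_bswap0 // eqxx.
rewrite !fE !gE !(c1, c2, c3, c4) -/x -/y ?opprK !mulrN ?opprK.
rewrite -(opprB y x) -(opprD x y) (addrC y x) !gcoefN !invrN.
rewrite (_ : - x + y = y - x); last by rewrite addrC.
apply/rowP => k; rewrite !lin2_mxE.
have x0 : x != 0.
  by rewrite /x bcE mulf_neq0 ?invr_eq0 ?pnatr_eq0 // intr_eq0 bcZ_neq0.
have y0 : y != 0.
  by rewrite /y bcE mulf_neq0 ?invr_eq0 ?pnatr_eq0 // intr_eq0 bcZ_neq0.
have yx0 : y - x != 0.
  rewrite /y /x !bcE -mulrBl -rmorphB /=.
  by rewrite mulf_neq0 ?invr_eq0 ?pnatr_eq0 // intr_eq0 subr_eq0 -pi bcZ_adj.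
have xy0 : x + y != 0.
  rewrite /y /x !bcE -mulrDl -rmorphD /=.
  by rewrite mulf_neq0 ?invr_eq0 ?pnatr_eq0 // intr_eq0 addrC -pi bcZ_adj0.
apply: braid4_identity; rewrite ?gcoef2 //.
  by field; rewrite x0 xy0 yx0.
by field; rewrite y0 xy0 yx0.
Qed.

End Matrices.

(** * The copy of Young's representation on all-positive tableaux, and its generation of the whole
    space *)

Section Positive.
Variables (mu nu : seq nat) (n m : nat).
Hypotheses (skew : is_skew_shape mu nu) (m0 : (0 < m)%N).
Local Notation cellT := ('I_(size mu) * 'I_(head 0%N mu))%type.
Local Notation btab := (btab mu n).
Local Notation BT := (BT mu nu n).
Local Notation SYT := (SYT mu nu n).
Local Notation bswap := (@bswap mu n).
Local Notation bf := (@bf mu nu n m).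
Local Notation bvec := (@bvec mu nu n).
Local Notation M := (@btab_mx mu nu n m).

Definition pos (Q : {ffun 'I_n -> cellT}) : btab := [ffun k => (Q k, false)].

Lemma bcell_pos Q : bcell (pos Q) =1 Q.
Proof. by move=> k; rewrite /bcell ffunE. Qed.

Lemma bentry_pos Q k : bentry (pos Q) k = (k.+1)%:Z.
Proof. by rewrite bentryE ffunE. Qed.

Lemma pos_BT Q : (pos Q \in BT) = (Q \in SYT).
Proof.
rewrite !inE; congr [&& _, _, _, _ & _].
- by apply/injectiveP/injectiveP => h k l; have := h k l; rewrite !bcell_pos.
- by apply: eq_forallb => k; rewrite bcell_pos.
- by apply: eq_forallb => b; rewrite (eq_codom (bcell_pos Q)).
- by do 2![apply: eq_forallb => ?]; rewrite !bcell_pos !bentry_pos.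
by do 2![apply: eq_forallb => ?]; rewrite !bcell_pos !bentry_pos.
Qed.

Lemma bswap_pos (i : 'I_n) Q : (0 < i)%N -> bswap i (pos Q) = pos (syt_swap i Q).
Proof. by move=> i0; apply/ffunP => k; rewrite bswapE // !ffunE. Qed.

Lemma bf_pos (i : 'I_n) Q : (0 < i)%N -> bf i (pos Q) = syt_h i Q.
Proof.
move=> i0; rewrite /bf gtn_eqF // /bc !ffunE /bcontent_cell !bcell_pos /syt_h.
rewrite /= opprD addrACA subrr addr0 -rmorphB /=; congr (_%:~R); ring.
Qed.

Definition posmx : 'M[algC]_(#|SYT|, #|BT|) := \matrix_a bvec (pos (enum_val a)).

(** Holds for nonstandard [X] too, both sides then being zero; this covers swaps that leave the set
    of standard tableaux. *)
Lemma sum_bvec_pos X (c : algC) :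
  \sum_(b < #|SYT|) ((enum_val b == X)%:R * c) *: bvec (pos (enum_val b))
  = c *: bvec (pos X).
Proof.
case: (boolP (X \in SYT)) => XS; last first.
  rewrite [bvec _]bvec_out ?pos_BT // scaler0 big1 // => b _.
  case: eqP => [e|_]; last by rewrite mul0r scale0r.
  by rewrite -e enum_valP in XS.
rewrite (bigD1 (enum_rank_in XS X)) //= enum_rankK_in // eqxx mul1r big1 ?addr0 //.
move=> b bX; case: eqP => [e|_]; last by rewrite mul0r scale0r.
by case/eqP: bX; apply: enum_val_inj; rewrite enum_rankK_in.
Qed.

(** For [i > 0] the shift of contents cancels in the difference, so [bf i] agrees with [syt_h i] on
    positive tableaux and the two formulas coincide. *)
Lemma young_posmx (i : 'I_n) : (0 < i)%N -> young_mx mu nu i *m posmx = posmx *m M i.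
Proof.
move=> i0; apply/row_matrixP => a; rewrite !row_mul mulmx_sum_row rowK.
rewrite (bvec_mul m skew) bf_pos // bswap_pos // -!sum_bvec_pos -big_split /=.
by apply: eq_bigr => b _; rewrite !mxE rowK -scalerDl.
Qed.

(** Measure for the induction in [posmx_generates], the total absolute value of the negative
    entries. It drops when -1 becomes 1 and when a minus sign moves to the next smaller absolute
    value. *)
Definition negweight (T : btab) : nat := \sum_(k < n) (if (T k).2 then k.+1 else 0).

Lemma negweight_bswap0 (j : 'I_n) (T : btab) : j = 0%N :> nat -> (T j).2 ->
  (negweight (bswap j T) < negweight T)%N.
Proof.
move=> j0 Tj; rewrite /negweight (bigD1 j) //= [X in (_ < X)%N](bigD1 j) //= Tj.
rewrite bswap0E // eqxx Tj /= add0n j0 add1n ltnS leq_eqVlt; apply/orP; left.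
by apply/eqP/eq_bigr => k kj; rewrite bswap0E // (negPf kj) /= addbF.
Qed.

Lemma negweight_bswap (j : 'I_n) (T : btab) : (0 < j)%N -> (T j).2 -> ~~ (T (predo j)).2 ->
  (negweight (bswap j T) < negweight T)%N.
Proof.
move=> j0 Tj Tp; rewrite /negweight (reindex_inj (@perm_inj _ (tperm (predo j) j))) /=.
under eq_bigr do rewrite bswapE // tpermK.
rewrite (bigD1 j) //= [X in (_ < X)%N](bigD1 j) //= Tj tpermR /=.
set A := (\sum_(_ < _ | _) _)%N; set B := (\sum_(_ < _ | _) _)%N.
(* Away from [j] the summands agree: at [predo j] both vanish, the entry being positive, and
   elsewhere the transposition is trivial. *)
have -> : A = B; last by lia.
apply: eq_bigr => k kj; case: (eqVneq k (predo j)) => [->|kp].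
  by rewrite (negPf Tp).
by rewrite tpermD // eq_sym.
Qed.

(** Here [bf j T] is an odd integer of absolute value at least 3, hence not 1 or -1. *)
Lemma gcoef_flip0 (j : 'I_n) (T : btab) : T \in BT -> j = 0%N :> nat -> gcoef (bf j T) != 0.
Proof.
move=> TB j0; rewrite gcoef_eq0 bfE j0 /= -rmorphXn -(rmorph1 (intr : int -> algC)).
rewrite eqr_int; have := bcZ_ge3 m0 j TB; case: (T j).2; nia.
Qed.

(** The contents are at most [-3/2] and at least [3/2], so they differ by at least 3. *)
Lemma gcoef_sign (j : 'I_n) (T : btab) : T \in BT -> (0 < j)%N ->
  (T j).2 -> ~~ (T (predo j)).2 -> gcoef (bf j T) != 0.
Proof.
move=> TB j0 Tj Tp; rewrite gcoef_eq0 bfE gtn_eqF //.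
have := bcZ_ge3 m0 j TB; have := bcZ_ge3 m0 (predo j) TB; rewrite Tj (negPf Tp).
move: (bcZ _ _ _ _) (bcZ _ _ _ _) => x y hx hy.
rewrite expr_div_n -(inj_eq (mulIf (_ : (2 : algC) ^+ 2 != 0))); last first.
  by rewrite expf_neq0 // pnatr_eq0.
rewrite divfK ?expf_neq0 ?pnatr_eq0 // mul1r -rmorphXn -natrX.
rewrite (_ : (2 ^ 2)%:R = (4%:Z)%:~R) // eqr_int; nia.
Qed.

Lemma posmx_generates p (W : 'M[algC]_(p, #|BT|)) : (posmx <= W)%MS ->
  (forall i, (W *m M i <= W)%MS) -> row_full W.
Proof.
move=> sW stW; have main : forall T, (bvec T <= W)%MS; last first.
  rewrite -sub1mx; apply/row_subP => a; rewrite row1 -bvec_delta; exact: main.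
move=> T; elim: {T}(negweight T).+1 {-2}T (ltnSn (negweight T)) => // w IH T.
rewrite ltnS => Tw; case: (boolP (T \in BT)) => TB; last by rewrite bvec_out ?sub0mx.
have step j : gcoef (bf j T) != 0 -> (negweight (bswap j T) < negweight T)%N ->
  (bvec T <= W)%MS.
  move=> g0 lt; have IHj := IH (bswap j T) (leq_trans lt Tw).
  have := bvec_mul m skew (bswap j T) j; rewrite bswapK bf_bswap gcoefN => E.
  (* The action of [M j] on [bvec (bswap j T)] is solved for [bvec T], dividing by the nonzero
     off-diagonal coefficient. *)
  rewrite -[bvec T]scale1r -(mulVf g0) -scalerA scalemx_sub //.
  rewrite -[_ *: _](addKr ((- bf j T)^-1 *: bvec (bswap j T))) -E.
  rewrite addmx_sub //; first by rewrite eqmx_opp scalemx_sub.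
  by apply: submx_trans (stW j); apply: submxMr.
case: (pickP (fun j => (T j).2)) => [j0 Tj0|noneg]; last first.
  pose Q := [ffun k => (T k).1].
  have ET : T = pos Q.
    by apply/ffunP => k; rewrite !ffunE -(noneg k) -surjective_pairing.
  have QS : Q \in SYT by rewrite -pos_BT -ET.
  have -> : bvec T = row (enum_rank_in QS Q) posmx by rewrite rowK enum_rankK_in // ET.
  exact: submx_trans (row_sub _ _) sW.
(* With the least negative index, either -1 occurs and can be flipped, or the preceding entry is
   positive and the minus sign can be moved down. *)
case: (@arg_minnP _ j0 (fun j => (T j).2) (fun j : 'I_n => j : nat) Tj0) => j Tj minj.
case: (posnP j) => jz.
  by apply: (step j); [apply: gcoef_flip0|apply: negweight_bswap0].
have Tp : ~~ (T (predo j)).2 by apply/negP => /minj /=; lia.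
by apply: (step j); [apply: gcoef_sign|apply: negweight_bswap].
Qed.

End Positive.

(** * Standardization of signed fillings and the resulting lower bound on their number *)

Section Standardization.
Variables (n : nat) (eps : {ffun 'I_n -> bool}).
Let sv k := Defs.sval (k, eps k).
Let below k := [set l | sv l < sv k].

Lemma below_lt k : (#|below k| < n)%N.
Proof.
rewrite -[X in (_ < X)%N]card_ord -cardsT; apply: proper_card; apply/properP.
by split; [apply: subsetT|exists k; rewrite !inE ?ltxx].
Qed.

(** Position of entry [k] when all entries, with signs [eps], are listed by increasing signed value;
    positions start at 0. *)
Definition sgnrank k : 'I_n := Ordinal (below_lt k).

Lemma signed_value_inj : injective sv.
Proof.
move=> k l e; apply: val_inj; move: e; rewrite /sv /Defs.sval /=.
by case: (eps k); case: (eps l); lia.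
Qed.

Lemma sgnrank_lt k l : (sgnrank k < sgnrank l)%N = (sv k < sv l).
Proof.
have mono a b : sv a < sv b -> (sgnrank a < sgnrank b)%N.
  move=> ab; apply: proper_card; apply/properP; split.
    by apply/subsetP => c; rewrite !inE => /lt_trans; apply.
  by exists a; rewrite !inE ?ltxx.
case: (ltP (sv k) (sv l)) => [/mono //|];
rewrite le_eqVlt => /orP[/eqP/signed_value_inj->|/mono].
  by rewrite ltnn.
by move=> h; apply/negbTE; rewrite -leqNgt ltnW.
Qed.

Lemma sgnrank_inj : injective sgnrank.
Proof.
move=> k l e; have := sgnrank_lt k l; have := sgnrank_lt l k; rewrite e ltnn.
by move=> h1 h2; apply: signed_value_inj; apply/le_anti; rewrite !leNgt -h1 -h2.
Qed.

End Standardization.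

Section Counting.
Variables (mu nu : seq nat) (n : nat).
Local Notation cellT := ('I_(size mu) * 'I_(head 0%N mu))%type.
Local Notation btab := (btab mu n).
Local Notation BT := (BT mu nu n).
Local Notation SYT := (SYT mu nu n).

(** Inverse of standardization: the values in a standard tableau are replaced by the signed values
    of the same rank. *)
Definition signed (x : {ffun 'I_n -> cellT} * {ffun 'I_n -> bool}) : btab :=
  [ffun k => (x.1 (sgnrank x.2 k), x.2 k)].

Lemma signed_inj : injective signed.
Proof.
move=> [Q e] [Q' e'] /ffunP h.
have ee : e = e' by apply/ffunP => k; have := h k; rewrite !ffunE /= => -[].
subst e'; congr (_, _); apply/ffunP => k.
have [g gK Kg] := injF_bij (@sgnrank_inj _ e).
by have := h (g k); rewrite !ffunE /= Kg => -[].
Qed.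

Lemma signed_BT Q e : Q \in SYT -> signed (Q, e) \in BT.
Proof.
rewrite inE => /and5P[/injectiveP h1 /forallP h2 /forallP h3 /forallP h4 /forallP h5].
have c k : bcell (signed (Q, e)) k = Q (sgnrank e k) by rewrite /bcell ffunE.
have en k l : (bentry (signed (Q, e)) k < bentry (signed (Q, e)) l)
  = (sgnrank e k < sgnrank e l)%N by rewrite sgnrank_lt /bentry !ffunE.
apply: BTI.
- by move=> k l; rewrite !c => /h1/sgnrank_inj.
- by move=> k; rewrite c.
- move=> b bs; have := h3 b; rewrite bs /= => /codomP[k ->].
  by have [g gK Kg] := injF_bij (@sgnrank_inj _ e); exists (g k); rewrite c Kg.
- move=> k l; rewrite !c en => E lt; have /forallP/(_ (sgnrank e l)) := h4 (sgnrank e k).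
  by rewrite /same_row E eqxx lt.
move=> k l; rewrite !c en => E lt; have /forallP/(_ (sgnrank e l)) := h5 (sgnrank e k).
by rewrite /same_col E eqxx lt.
Qed.

(** An inequality suffices, since surjectivity of the intertwiner supplies the opposite one. *)
Lemma card_BT_ge : (2 ^ n * #|SYT| <= #|BT|)%N.
Proof.
have -> : (2 ^ n * #|SYT| = #|setX SYT [set: {ffun 'I_n -> bool}]|)%N.
  by rewrite cardsX cardsT card_ffun card_bool card_ord mulnC.
rewrite -(card_imset _ signed_inj); apply: subset_leq_card.
by apply/subsetP => _ /imsetP[[Q e] + ->]; rewrite in_setX in_setT andbT => /signed_BT.
Qed.

End Counting.

(** * Induced representations and Frobenius reciprocity in matrix form *)

Section InducedTheory.
Variables (T : finGroupType) (G H : {group T}) (d : nat) (sigma : T -> 'M[algC]_d).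
Hypotheses (sHG : H \subset G) (sigmaP : mx_repr H sigma).
Local Notation X := (rtrans G H).
Local Notation ind := (ind_rep G H sigma).

Definition crep (x : T) : T := transversal_repr 1%g X (H :* x)%g.

Lemma rtransP : is_transversal X (rcosets H G) G.
Proof. by apply: transversalP; apply: rcosets_partition. Qed.

Lemma rtrans_sub x : x \in X -> x \in G.
Proof. by apply/subsetP; apply: transversal_sub rtransP. Qed.

Lemma crep_mem x : x \in G -> crep x \in X.
Proof.
move=> xG; apply: (repr_mem_transversal rtransP).
by apply/imsetP; exists x; rewrite ?rcosetE.
Qed.

Lemma crep_coset x : x \in G -> (x * (crep x)^-1)%g \in H.
Proof.
move=> xG; have : crep x \in (H :* x)%g.
  by apply: (repr_mem_pblock rtransP); apply/imsetP; exists x; rewrite ?rcosetE.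
by rewrite mem_rcoset => h; rewrite -groupV invMg invgK.
Qed.

Lemma crepM h x : h \in H -> crep (h * x)%g = crep x.
Proof. by move=> hH; rewrite /crep rcosetM (rcoset_id hH). Qed.

Definition blockrow N (F : T -> 'M[algC]_(d, N)) : 'M[algC]_(\sum_(a < #|X|) d, N) :=
  \mxcol_(a < #|X|) F (enum_val a).

Definition equivariant N (F : T -> 'M[algC]_(d, N)) :=
  forall h x, h \in H -> x \in G -> F (h * x)%g = sigma h *m F x.

(** In the block row of [t] only the representative [t'] of the coset of [t g] contributes, giving
    [sigma (t g t'^-1) *m F t'], which equivariance turns into [F (t g)]. *)
Lemma ind_blockrow N (F : T -> 'M[algC]_(d, N)) g : equivariant F -> g \in G ->
  ind g *m blockrow F = blockrow (fun x => F (x * g)%g).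
Proof.
move=> eF gG; rewrite /ind_rep /blockrow mul_mxblock_mxrow; apply: eq_mxcol => a.
have aG := rtrans_sub (enum_valP a); have agG := groupM aG gG.
have cX := crep_mem agG.
rewrite (bigD1 (enum_rank_in cX (crep (enum_val a * g)))) //= enum_rankK_in //.
rewrite -/(crep _) eqxx big1 ?addr0; last first.
  move=> b bX; case: eqP => [e|_]; last by rewrite mul0mx.
  by case/eqP: bX; apply: enum_val_inj; rewrite enum_rankK_in.
by have <- := eF _ _ (crep_coset agG) (rtrans_sub cX); rewrite mulgKV.
Qed.

Lemma indM : {in G &, {morph ind : x y / (x * y)%g >-> x *m y}}.
Proof.
move=> x y xG yG.
(* The block rows of [ind y] themselves form an equivariant function, so multiplicativity is an
   instance of [ind_blockrow]. *)
pose F (z : T) : 'M[algC]_(d, \sum_(a < #|X|) d) := \mxrow_(b < #|X|)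
  (if enum_val b == crep (z * y)%g then sigma (z * y * (enum_val b)^-1)%g else 0).
have E : ind y = blockrow F by rewrite /ind_rep mxblockEv.
rewrite [in RHS]E ind_blockrow //.
  by rewrite /ind_rep mxblockEv; apply: eq_mxcol => a; apply: eq_mxrow => b; rewrite mulgA.
move=> h z hH zG; rewrite /F mul_mxrow; apply: eq_mxrow => b.
rewrite -!mulgA crepM //; case: eqP => [->|_]; last by rewrite mulmx0.
case: sigmaP => _ sM; rewrite sM //.
by rewrite mulgA crep_coset // groupM.
Qed.

End InducedTheory.

(** * The groups [Bn] and [Sn], and the factorization into a permutation and a sign change *)

Lemma Bn_group_set n : group_set (Bn n).
Proof.
apply/group_setP; split.
  by rewrite inE; apply/forallP => x; rewrite !perm1.
move=> p q; rewrite !inE => /forallP hp /forallP hq; apply/forallP => x.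
by rewrite !permM (eqP (hp x)) (eqP (hq _)).
Qed.
Canonical Bn_group n := Group (Bn_group_set n).

Lemma Sn_group_set n : group_set (Sn n).
Proof.
apply/group_setP; split.
  rewrite inE (group1 (Bn_group n)); apply/forallP => x; by rewrite !perm1.
move=> p q; rewrite inE => /andP[pB /forallP hp]; rewrite inE => /andP[qB /forallP hq].
rewrite inE (groupM (G := Bn_group n)) //=; apply/forallP => x.
by rewrite permM (eqP (hq _)).
Qed.
Canonical Sn_group n := Group (Sn_group_set n).

Lemma Sn_sub n : Sn n \subset Bn n.
Proof. by apply/subsetP => x; rewrite inE => /andP[]. Qed.

Section SignPart.
Variable n : nat.
Implicit Types t p : gT n.

Lemma BnP t : reflect (forall k b, t (k, ~~ b) = negs (t (k, b))) (t \in Bn n).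
Proof.
rewrite inE; apply: (iffP forallP) => [h k b|h [k b]].
  by have /eqP := h (k, b).
by rewrite -h.
Qed.

Lemma Bn_signE t k b : t \in Bn n -> t (k, b) = ((t (k, false)).1, (t (k, false)).2 (+) b).
Proof.
move=> /BnP h; case: b; last by rewrite addbF -surjective_pairing.
by rewrite (h k false) /negs addbT.
Qed.

Lemma sgen_Bn (i : 'I_n) : sgen i \in Bn n.
Proof.
apply/BnP => k b; rewrite !sgenE; case: ifP => _ //; by rewrite /negs /= addNb.
Qed.

Lemma sgen_Sn (i : 'I_n) : (0 < i)%N -> sgen i \in Sn n.
Proof.
move=> i0; rewrite inE sgen_Bn; apply/forallP => -[k b].
by rewrite sgenE gtn_eqF.
Qed.

(* [j] is in [sgnset t] iff [t] maps some positive integer to [-(j+1)]. *)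
Definition sgnset t (j : 'I_n) : bool := ((t^-1)%g (j, false)).2.

Definition flip_fun (A : 'I_n -> bool) (x : sgn_elt n) : sgn_elt n := (x.1, x.2 (+) A x.1).

Lemma flip_funK A : involutive (flip_fun A).
Proof. by move=> [k b]; rewrite /flip_fun /= -addbA addbb addbF. Qed.

Definition flip (A : 'I_n -> bool) : gT n := perm (inv_inj (flip_funK A)).

Lemma flipE A k b : flip A (k, b) = (k, b (+) A k).
Proof. by rewrite permE. Qed.

Lemma flip_Bn A : flip A \in Bn n.
Proof. by apply/BnP => k b; rewrite !flipE /negs /= addNb. Qed.

(** Products act left to right, so [flip] corrects the signs of the values of [t]. As [flip] is an
    involution, [t] is an element of [Sn] followed by [flip (sgnset t)]. *)
Lemma sgnset_flip_Sn t : t \in Bn n -> (t * flip (sgnset t))%g \in Sn n.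
Proof.
move=> tB; rewrite inE groupM ?flip_Bn //=; apply/forallP => -[k b].
rewrite permM; case E : (t (k, b)) => [j c]; rewrite flipE /= /sgnset.
have : (t^-1)%g (j, c) = (k, b) by rewrite -E permK.
rewrite Bn_signE ?groupV // => -[_ <-].
by rewrite addbC.
Qed.

Lemma sgnsetM p t j : p \in Sn n -> sgnset (p * t)%g j = sgnset t j.
Proof.
rewrite -groupV inE => /andP[_ /forallP h].
by rewrite /sgnset invMg permM (eqP (h _)).
Qed.

Lemma sgnset_sgen (i : 'I_n) t j : (0 < i)%N ->
  sgnset (t * sgen i)%g j = sgnset t (tperm (predo i) i j).
Proof. by move=> i0; rewrite /sgnset invMg permM sgenV sgenE gtn_eqF. Qed.

Lemma sgnset_sgen0 (i : 'I_n) t j : t \in Bn n -> i = 0%N :> nat ->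
  sgnset (t * sgen i)%g j = sgnset t j (+) (j == i).
Proof.
move=> tB i0; rewrite /sgnset invMg permM sgenV sgenE i0 /= Bn_signE ?groupV //.
Qed.

Lemma flip_sgen (i : 'I_n) A B : (0 < i)%N -> (forall j, B j = A (tperm (predo i) i j)) ->
  (sgen i * flip B = flip A * sgen i)%g.
Proof.
move=> i0 BA; apply/permP => -[k b].
by rewrite !permM sgenE gtn_eqF // !flipE sgenE gtn_eqF // BA tpermK.
Qed.

Lemma flip_sgen0 (i : 'I_n) A B : i = 0%N :> nat -> (forall j, B j = A j (+) (j == i)) ->
  (sgen i * flip B = flip A)%g.
Proof.
move=> i0 BA; apply/permP => -[k b].
rewrite !permM sgenE i0 /= !flipE BA; congr (_, _).
by case: b; case: (A k); case: (k == i).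
Qed.

Lemma eq_flip A B : A =1 B -> flip A = flip B.
Proof. by move=> AB; apply/permP => -[k b]; rewrite !flipE AB. Qed.

(** Elements with equal sign sets become elements of [Sn] after the same flip, so they share a right
    coset; hence [sgnset] is injective on a transversal. *)
Lemma card_rtrans_le : (#|rtrans (Bn n) (Sn n)| <= 2 ^ n)%N.
Proof.
pose f t := [ffun j => sgnset t j].
have -> : (2 ^ n = #|{ffun 'I_n -> bool}|)%N by rewrite card_ffun card_bool card_ord.
have trP := rtransP (Sn_sub n : Sn_group n \subset Bn_group n).
rewrite -(@card_in_imset _ _ f _ _) ?max_card // => x y xX yX /ffunP fxy.
have [xB yB] : x \in Bn n /\ y \in Bn n by split; apply: (rtrans_sub (Sn_sub n)).
apply: (pblock_inj trP) => //.
have ti : trivIset (rcosets (Sn n) (Bn n)) by case/andP: trP => /and3P[].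
have xC : (Sn n :* x)%g \in rcosets (Sn n) (Bn n).
  by apply/imsetP; exists x; rewrite ?rcosetE.
have sxy : flip (sgnset x) = flip (sgnset y).
  by apply: eq_flip => j; have := fxy j; rewrite !ffunE.
rewrite (def_pblock ti xC (rcoset_refl _ x)) (def_pblock ti xC) // mem_rcoset.
have := groupM (sgnset_flip_Sn yB) (groupVr (sgnset_flip_Sn xB)).
by rewrite invMg sxy !mulgA mulgK.
Qed.

End SignPart.

(** * The intertwiner from the induced module and its bijectivity *)

Section Intertwiner.
Variables (mu nu : seq nat) (n m : nat).
Hypotheses (skew : is_skew_shape mu nu) (m0 : (0 < m)%N).
Variable sigma : gT n -> 'M[algC]_(#|SYT mu nu n|).
Hypothesis sigmaP : mx_repr (Sn n) sigma.
Hypothesis sigma_gen : forall i : 'I_n, (0 < i)%N -> sigma (sgen i) = young_mx mu nu i.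
Local Notation M := (@btab_mx mu nu n m).
Local Notation N := #|BT mu nu n|.

(** Extends the matrices to natural indices, by the identity out of range, to fit the ring-theoretic
    results on [refl]. *)
Definition btab_mxn (k : nat) : 'M[algC]_N := if insub k is Some i then M i else 1%:M.

Lemma btab_mxnE (i : 'I_n) : btab_mxn i = M i.
Proof. by rewrite /btab_mxn valK. Qed.

Lemma btab_mxn_inv i : (i < n)%N -> btab_mxn i * btab_mxn i = 1.
Proof.
by move=> lin; rewrite -[i]/(val (Ordinal lin)) !btab_mxnE; exact: btab_mxK.
Qed.

Lemma btab_mxn_comm i j : (i.+1 < j)%N -> (j < n)%N ->
  btab_mxn i * btab_mxn j = btab_mxn j * btab_mxn i.
Proof.
move=> ij jn; have lin : (i < n)%N by lia.
rewrite -[i]/(val (Ordinal lin)) -[j]/(val (Ordinal jn)) !btab_mxnE.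
exact: btab_mx_comm.
Qed.

Lemma btab_mxn_braid3 i : (0 < i)%N -> (i.+1 < n)%N ->
  btab_mxn i * btab_mxn i.+1 * btab_mxn i = btab_mxn i.+1 * btab_mxn i * btab_mxn i.+1.
Proof.
move=> i0 jn; have lin : (i < n)%N by lia.
rewrite -[i.+1]/(val (Ordinal jn)) -[i]/(val (Ordinal lin)) !btab_mxnE.
exact: btab_mx_braid3.
Qed.

Lemma btab_mxn_braid4 : (1 < n)%N ->
  btab_mxn 0 * btab_mxn 1 * btab_mxn 0 * btab_mxn 1 =
  btab_mxn 1 * btab_mxn 0 * btab_mxn 1 * btab_mxn 0.
Proof.
move=> n1; have n0 : (0 < n)%N by lia.
rewrite -[0%N]/(val (Ordinal n0)) -[1%N]/(val (Ordinal n1)) !btab_mxnE.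
exact: btab_mx_braid4.
Qed.

Definition sgnsetn (t : gT n) (k : nat) : bool :=
  if insub k is Some j then sgnset t j else false.

Lemma sgnsetnE t (j : 'I_n) : sgnsetn t j = sgnset t j.
Proof. by rewrite /sgnsetn valK. Qed.

(** With [t] written as [p] in [Sn] followed by a flip, this is [sigma p], then the embedding of
    positive tableaux, then the matrix modelling the flip. *)
Definition frob (t : gT n) : 'M[algC]_(#|SYT mu nu n|, N) :=
  sigma (t * flip (sgnset t))%g *m posmx mu nu n *m reflset btab_mxn (sgnsetn t) n.

Lemma frob_equivariant : equivariant (Bn_group n) (Sn_group n) sigma frob.
Proof.
move=> h x hS xB; rewrite /frob.
have e j : sgnset (h * x)%g j = sgnset x j by apply: sgnsetM.
have -> : reflset btab_mxn (sgnsetn (h * x)%g) n = reflset btab_mxn (sgnsetn x) n.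
  by apply: eq_reflset => j jn; rewrite -[j]/(val (Ordinal jn)) !sgnsetnE.
rewrite (eq_flip e) -mulgA; case: sigmaP => _ -> //; first by rewrite !mulmxA.
exact: sgnset_flip_Sn.
Qed.

(** For [i = 0] the generator only toggles the sign of entry 1. For [i > 0] it passes the sign
    changes, permuting them, and then the embedding by [young_posmx], to be absorbed into
    [sigma]. *)
Lemma frob_sgen (i : 'I_n) t : t \in Bn n -> frob (t * sgen i)%g = frob t *m M i.
Proof.
move=> tB; have hMM := btab_mxn_inv; have hMc := btab_mxn_comm.
have hb3 := btab_mxn_braid3; have hb4 := btab_mxn_braid4.
rewrite /frob -!mulmxA -mulgA; case: (posnP i) => i0.
  have e j : sgnset (t * sgen i)%g j = sgnset t j (+) (j == i) by apply: sgnset_sgen0.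
  rewrite (flip_sgen0 i0 e); congr (_ *m (_ *m _)).
  have n0 : (0 < n)%N by have := ltn_ord i; lia.
  rewrite -(btab_mxnE i) i0 mulmxE (reflset_flip hMM hMc hb3 hb4) //.
  apply: eq_reflset => j jn; rewrite -[j]/(val (Ordinal jn)) !sgnsetnE e.
  by rewrite -(inj_eq val_inj) /= i0.
have e j : sgnset (t * sgen i)%g j = sgnset t (tperm (predo i) i j) by apply: sgnset_sgen.
rewrite (flip_sgen i0 e) mulgA; case: sigmaP => _ ->; last 2 first.
- exact: sgnset_flip_Sn.
- exact: sgen_Sn.
rewrite sigma_gen // -!mulmxA; congr (_ *m _); rewrite mulmxA (young_posmx m skew i0).
rewrite -mulmxA; congr (_ *m _); rewrite -(btab_mxnE i) mulmxE.
rewrite (reflset_swap hMM hMc hb3 hb4) ?i0 ?ltn_ord //; congr (_ * _).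
apply: eq_reflset => j jn; rewrite /= -[j]/(nat_of_ord (Ordinal jn)).
by rewrite -val_tperm_predo !sgnsetnE e.
Qed.

Lemma frob1 : frob 1%g = posmx mu nu n.
Proof.
have e j : sgnset (1 : gT n)%g j = false by rewrite /sgnset invg1 perm1.
rewrite /frob; have -> : (1 * flip (sgnset 1))%g = 1%g :> gT n.
  by rewrite mul1g; apply/permP => -[k b]; rewrite flipE e perm1 addbF.
case: sigmaP => -> _; rewrite mul1mx /reflset big1 ?mulmx1 // => j _.
by rewrite /reflX sgnsetnE e.
Qed.

Definition frobmx := blockrow (Bn_group n) (Sn_group n) frob.

Lemma ind_frobmx_sgen i :
  ind_rep (Bn n) (Sn n) sigma (sgen i) *m frobmx = frobmx *m M i.
Proof.
rewrite (ind_blockrow (Sn_sub n) frob_equivariant) ?sgen_Bn //.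
rewrite /frobmx /blockrow mxcol_mul; apply: eq_mxcol => a.
by apply: frob_sgen; apply: (rtrans_sub (Sn_sub n)); apply: enum_valP.
Qed.

(** The transversal need not contain 1, but the representative [c] of the coset [Sn] lies in [Sn],
    and equivariance gives [frob 1 = sigma c^-1 *m frob c]. *)
Lemma posmx_sub_frobmx : (posmx mu nu n <= frobmx)%MS.
Proof.
have cX : crep (Bn_group n) (Sn_group n) 1%g \in rtrans (Bn n) (Sn n).
  by apply: (crep_mem (Sn_sub n)); apply: group1.
set c := crep _ _ _ in cX.
have cS : c^-1%g \in Sn n.
  by rewrite -[c^-1%g]mul1g; apply: (crep_coset (Sn_sub n)); apply: group1.
rewrite -frob1 -(mulVg c) (frob_equivariant cS) ?(rtrans_sub (Sn_sub n)) //.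
apply: mulmx_sub.
have -> : frob c = submxcol frobmx (enum_rank_in cX c).
  by rewrite /frobmx /blockrow mxcolK enum_rankK_in.
by rewrite -{1}[frobmx]mul1mx -submxcol_mul submxMl.
Qed.

Lemma frobmx_full : row_full frobmx.
Proof.
apply: (posmx_generates skew m0 posmx_sub_frobmx) => i.
by rewrite -ind_frobmx_sgen submxMl.
Qed.

(** Full column rank bounds [N] by the dimension of the induced module; standardization and the
    count of cosets give the reverse bound. *)
Lemma card_ind : N = (\sum_(a < #|rtrans (Bn n) (Sn n)|) #|SYT mu nu n|)%N.
Proof.
apply/eqP; rewrite eqn_leq; apply/andP; split.
  by rewrite -{1}(eqP frobmx_full) rank_leq_row.
rewrite sum_nat_const card_ord. apply: leq_trans (card_BT_ge mu nu n).
by rewrite leq_mul2r card_rtrans_le orbT.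
Qed.

Lemma frobmx_free : row_free frobmx.
Proof. by rewrite /row_free (eqP frobmx_full) {1}card_ind. Qed.

End Intertwiner.

Unset Implicit Arguments.

Theorem theorem6p10 (n : nat) (mu nu : seq nat) (m : nat) :
  is_skew_shape mu nu -> (sumn mu - sumn nu)%N = n -> (0 < m)%N ->
  forall sigma : gT n -> 'M[algC]_(#|SYT mu nu n|),
    mx_repr (Sn n) sigma ->
    (forall i : 'I_n, (0 < i)%N -> sigma (sgen i) = young_mx mu nu i) ->
  exists rho : gT n -> 'M[algC]_(#|BT mu nu n|),
    [/\ mx_repr (Bn n) rho,
        (forall i : 'I_n, rho (sgen i) = btab_mx mu nu m i) &
        rep_iso (Bn n) rho (ind_rep (Bn n) (Sn n) sigma)].
Proof.
move=> skew _ m0 sigma sigmaP sigma_gen.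
have [D DC CD] : exists2 D, D *m frobmx m sigma = 1%:M & frobmx m sigma *m D = 1%:M.
  exists (pinvmx (frobmx m sigma)).
    exact/mulVpmx/(frobmx_full skew m0 sigmaP sigma_gen).
  exact/mulmxVp/(frobmx_free skew m0 sigmaP sigma_gen).
(* Transporting the induced action makes multiplicativity automatic on the whole group; only the
   values on generators have to be identified, by [ind_frobmx_sgen]. *)
exists (fun x => D *m ind_rep (Bn n) (Sn n) sigma x *m frobmx m sigma); split.
- split.
    rewrite -mulmxA (ind_blockrow (Sn_sub n) (frob_equivariant m sigmaP)) ?group1 //.
    by rewrite -[RHS]DC; congr (_ *m _); apply: eq_mxcol => a; rewrite mulg1.
  move=> x y xB yB /=; rewrite (indM (Sn_sub n) sigmaP) //.
  by rewrite !mulmxA -(mulmxA _ (frobmx m sigma) D) CD mulmx1.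
- move=> i; rewrite -mulmxA (ind_frobmx_sgen skew m0 sigmaP sigma_gen).
  by rewrite mulmxA DC mul1mx.
exists D; split; first exact: (card_ind skew m0 sigmaP sigma_gen).
  by apply/row_freeP; exists (frobmx m sigma).
by move=> x xB; rewrite -!mulmxA CD mulmx1.
Qed.
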